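(* Let $K\in[1,3/2)$. Then there is no infinite-dimensional Banach space (over $\mathbb K\in\{\mathbb R,\mathbb C\}$) with a $K$-unconditional basis having the super Alternative Daugavet property (super ADP).
   Context: $\mathbb T$ denotes the set of scalars of modulus one ($\mathbb T=\{-1,1\}$ if $\mathbb K=\mathbb R$, the unit circle if $\mathbb K=\mathbb C$). $B_X$ and $S_X$ are the closed unit ball and unit sphere of a Banach space $X$. Super ADP: $X$ has the super ADP if for every $x\in S_X$ and every relatively weakly open set $W\subset B_X$ with $W\cap S_X\neq\varnothing$ one has $\sup_{y\in W}\max_{\theta\in\mathbb T}\|x+\theta y\|=2$. $K$-unconditional basis ($K\ge 1$): a Schauder basis $(e_j)_{j=1}^\infty$ of $X$ such that for every $N\in\mathbb N$ and all scalars $a_1,\dots,a_N,b_1,\dots,b_N$ with $|a_j|\le|b_j|$ for all $j$, one has $\left\|\sum_{j=1}^N a_je_j\right\|\le K\left\|\sum_{j=1}^N b_je_j\right\|$. *)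

(* Defs.v *)
From HB Require Import structures.
From mathcomp Require Import all_boot all_order all_algebra.
From mathcomp Require Import complex.
From mathcomp Require Import all_classical all_reals all_analysis.

Set Implicit Arguments.
Unset Strict Implicit.
Unset Printing Implicit Defensive.

Import Order.TTheory GRing.Theory Num.Theory.
Import numFieldTopology.Exports numFieldNormedType.Exports.

Local Open Scope classical_set_scope.
Local Open Scope ring_scope.

(* In a normedModType K the norm takes its values in K itself.  For K = R[i],
   the (partial) order of K satisfies x <= y iff Im x = Im y and Re x <= Re y,
   so on norms, and on the scalars above or below them, it is the usual order
   of the reals. *)
Variant real_or_complex (R : realType) : numFieldType -> Prop :=
| ScalarReal : real_or_complex R R
| ScalarComplex : real_or_complex R R[i].

Section BanachSpace.
Context {K : numFieldType}.

Definition unit_scalars : set K := [set t | `|t| = 1].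

Definition unit_ball (X : normedModType K) : set X := [set x | `|x| <= 1].

Definition unit_sphere (X : normedModType K) : set X := [set x | `|x| = 1].

Definition infinite_dimensional (X : lmodType K) : Prop :=
  ~ exists (n : nat) (v : 'I_n -> X),
      forall x : X, exists c : 'I_n -> K, x = \sum_(i < n) c i *: v i.

Definition dual_space (X : normedModType K) : Type :=
  {f : {scalar X} | continuous f}.

(* The coarsest topology on X making all f in the dual space continuous. *)
Definition weak_topology (X : normedModType K) : topologicalType :=
  @sup_topology X (dual_space X)
    (fun f => Topological.class (initial_topology (sval f : X -> K))).

Definition relatively_weakly_open (X : normedModType K) (B W : set X) : Prop :=
  exists2 U : set X, @open (weak_topology X) U & W = U `&` B.

Definition is_maximum (A : set K) (m : K) : Prop := A m /\ ubound A m.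

(* For every y the maximum over t exists, since unit_scalars is compact; hence
   the set below is not empty when W is not. *)
Definition super_ADP (X : normedModType K) : Prop :=
  forall (x : X) (W : set X),
    @unit_sphere X x ->
    relatively_weakly_open (@unit_ball X) W ->
    W `&` @unit_sphere X !=set0 ->
    isLub [set m | exists2 y, W y &
             is_maximum [set `|x + t *: y| | t in unit_scalars] m] 2.

Definition schauder_basis (X : normedModType K) (e : nat -> X) : Prop :=
  forall x : X, exists! a : nat -> K,
    series (fun j => a j *: e j) @ \oo --> x.

Definition unconditional_basis (X : normedModType K) (k : K) (e : nat -> X)
    : Prop :=
  schauder_basis e /\
  forall (N : nat) (a b : nat -> K),
    (forall j, (j < N)%N -> `|a j| <= `|b j|) ->
    `|\sum_(j < N) a j *: e j| <= k * `|\sum_(j < N) b j *: e j|.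

End BanachSpace.

(* Main.v *)
(** Suppose that [X] has the super ADP and a [k]-unconditional basis [e].
    Testing the super ADP at [x = e 0 / `|e 0|] on a weak neighbourhood of
    [e 1 / `|e 1|] gives vectors [u], [v] of the unit ball with disjoint finite
    supports and [s := `|u + v|] close to 2.  Test it again at
    [x = s^-1 (u + v)] on a weak neighbourhood of [y0 = s'^-1 (u - v)], with
    [s' := `|u - v|]: an element [y] of it is close to [y0 + z], where [z] is
    supported after [u] and [v].  For [t] of modulus one write [x + t (y0 + z)]
    as the image of [y0 + z] under a diagonal operator with entries of modulus
    at most one, hence of norm at most [k], plus a remainder in the span of [u]
    and [v].  In the real case one of [u], [v] cancels in [x + t y0], and the
    remainder has norm at most [1 / s]; for complex scalars the same bound
    follows from the parallelogram identity, as [s' / s <= 4 / 3].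
    Therefore 2 is at most about [k + 1 / 2]. *)

Require Import Defs.
From HB Require Import structures.
From mathcomp Require Import all_boot all_order all_algebra.
From mathcomp Require Import complex ring.
From mathcomp Require Import all_classical all_reals all_analysis.

Set Implicit Arguments.
Unset Strict Implicit.
Unset Printing Implicit Defensive.

Import Order.TTheory GRing.Theory Num.Theory.
Import numFieldTopology.Exports numFieldNormedType.Exports.

Local Open Scope classical_set_scope.
Local Open Scope ring_scope.

(** * Coordinates and partial sums in a Schauder basis *)

Section Coordinates.
Context {K : numFieldType} {X : normedModType K} {e : nat -> X}.
Hypothesis e_basis : schauder_basis e.

Definition coord (x : X) : nat -> K := projT1 (cid (e_basis x)).

Lemma cvg_coord x : series (fun j => coord x j *: e j) @ \oo --> x.
Proof. by rewrite /coord; case: cid => b /= []. Qed.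

Lemma coord_unique x a :
  series (fun j => a j *: e j) @ \oo --> x -> coord x = a.
Proof. by move=> xa; rewrite /coord; case: cid => b /= [_]; apply. Qed.

Lemma coordP a x y :
  coord (a *: x + y) = (fun j => a * coord x j + coord y j).
Proof.
apply: coord_unique.
rewrite (_ : series _ = a \*: series (fun j => coord x j *: e j)
                       + series (fun j => coord y j *: e j)).
  by apply: cvgD; [apply: cvgZl_tmp|]; exact: cvg_coord.
apply/funext => n; rewrite /series /= [RHS]/GRing.add /= scaler_sumr -big_split.
by apply: eq_bigr => j _; rewrite scalerDl scalerA.
Qed.

Lemma coord_linear j : linear_for *%R (coord^~ j : X -> K).
Proof. by move=> a x y; rewrite coordP. Qed.

Lemma coord0 j : coord 0 j = 0.
Proof.
have := coordP (-1) 0 0; rewrite scaler0 addr0 => /(congr1 (@^~ j)) /= ->.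
by rewrite mulN1r addNr.
Qed.

Lemma coordZ a x j : coord (a *: x) j = a * coord x j.
Proof. by rewrite -[a *: x]addr0 coordP coord0 addr0. Qed.

Lemma coordD x y j : coord (x + y) j = coord x j + coord y j.
Proof. by rewrite -[x]scale1r coordP mul1r scale1r. Qed.

Lemma coordN x j : coord (- x) j = - coord x j.
Proof. by rewrite -scaleN1r coordZ mulN1r. Qed.

Lemma coordB x y j : coord (x - y) j = coord x j - coord y j.
Proof. by rewrite coordD coordN. Qed.

Lemma coord_sum (a : nat -> K) N i :
  coord (\sum_(j < N) a j *: e j) i = if (i < N)%N then a i else 0.
Proof.
suff /coord_unique -> : series (fun j => (if (j < N)%N then a j else 0) *: e j)
    @ \oo --> \sum_(j < N) a j *: e j by [].
apply: cvg_near_cst; exists N => // n /= leNn.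
rewrite /series /= (big_cat_nat (n := N))//= [X in _ + X]big1_seq ?addr0.
  by rewrite big_mkord; apply: eq_bigr => j _; rewrite ltn_ord.
move=> j /=; rewrite mem_index_iota => /andP[leNj _].
by rewrite ltnNge leNj scale0r.
Qed.

Lemma coord_basis j i : coord (e j) i = (i == j)%:R.
Proof.
have -> : e j = \sum_(l < j.+1) (l == j :> nat)%:R *: e l.
  rewrite (bigD1 ord_max)//= eqxx scale1r big1 ?addr0// => l.
  by rewrite -val_eqE /= => /negPf ->; rewrite scale0r.
rewrite (coord_sum (fun l => (l == j)%:R)); case: ltnP => // ltji.
by rewrite gtn_eqF.
Qed.

Lemma basis_neq0 j : e j != 0.
Proof.
apply/eqP => e0; have := coord_basis j j.
by rewrite e0 coord0 eqxx => /esym/eqP; rewrite oner_eq0.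
Qed.

Definition trunc N (x : X) : X := \sum_(j < N) coord x j *: e j.

Lemma coord_trunc N x i :
  coord (trunc N x) i = if (i < N)%N then coord x i else 0.
Proof. exact: coord_sum. Qed.

Lemma cvg_trunc x : trunc ^~ x @ \oo --> x.
Proof.
rewrite (_ : trunc ^~ x = series (fun j => coord x j *: e j)).
  exact: cvg_coord.
by apply/funext => n; rewrite /series /= big_mkord.
Qed.

Lemma trunc_approx x eps : 0 < eps -> exists N, `|x - trunc N x| < eps.
Proof.
move=> eps0; have /cvgrPdist_lt/(_ _ eps0) := @cvg_trunc x.
by case=> N _ /(_ N (leqnn N)); exists N.
Qed.

(** * Norm comparison from unconditionality *)

Section Unconditional.
Context {k : K}.
Hypothesis e_unc : unconditional_basis k e.
Hypothesis k_gt0 : 0 < k.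

(** The defining inequality passes to the limit: both vectors are truncated at a common length, with
    an error for [y] small enough to survive the factor [k]. *)
Lemma unconditional_le x y :
  (forall j, `|coord x j| <= `|coord y j|) -> `|x| <= k * `|y|.
Proof.
move=> lexy; apply/ler_addgt0Pr => eps eps0.
have eps2 : 0 < eps / 2 by rewrite divr_gt0.
have epsk : 0 < eps / 2 / k by rewrite divr_gt0.
have /cvgrPdist_lt/(_ _ eps2) [N _ PN] := @cvg_trunc x.
have /cvgrPdist_lt/(_ _ epsk) [M _ PM] := @cvg_trunc y.
have {}PN := PN (maxn N M) (leq_maxl _ _).
have {}PM := PM (maxn N M) (leq_maxr _ _).
set n := maxn N M in PN PM.
rewrite -(subrK (trunc n x) x) (le_trans (ler_normD _ _))//.
have -> : k * `|y| + eps = eps / 2 + k * (`|y| + eps / 2 / k).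
  by field; rewrite gt_eqF.
rewrite lerD// ?(ltW PN)//.
apply: (le_trans (e_unc.2 n (coord x) (coord y) (fun j _ => lexy j))).
rewrite ler_wpM2l ?(ltW k_gt0)//.
rewrite -[leLHS]/(`|trunc n y|) -[trunc n y](subKr y).
by rewrite (le_trans (ler_normB _ _))// lerD2l ltW.
Qed.

(** Comparing [x] with its component along [e j] makes coordinates continuous, so that they cut out
    weakly open sets. *)
Lemma coord_bounded j x : `|coord x j| * `|e j| <= k * `|x|.
Proof.
rewrite -normrZ; apply: unconditional_le => i; rewrite coordZ coord_basis.
by case: eqP => [->|_]; rewrite ?mulr1// mulr0 normr0.
Qed.

Lemma trunc_id N x : (forall j, (N <= j)%N -> coord x j = 0) -> trunc N x = x.
Proof.
move=> xN; apply/eqP; rewrite -subr_eq0 -normr_le0.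
rewrite -[leRHS](mulr0 k) -(normr0 X); apply: unconditional_le => j.
rewrite coord0 coordB coord_trunc.
by case: ltnP => [_|/xN ->]; rewrite subrr.
Qed.

End Unconditional.
End Coordinates.

(** * Weak neighbourhoods and the super ADP *)

Section WeakTopology.
Context {K : numFieldType} {X : normedModType K}.

Lemma bounded_functional_continuous (f : {scalar X}) (M : K) :
  0 < M -> (forall x, `|f x| <= M * `|x|) -> continuous f.
Proof.
move=> M0 fM x; apply/cvgrPdist_lt => eps eps0.
have epsM : 0 < eps / M by rewrite divr_gt0.
have xnear : \forall y \near x, `|x - y| < eps / M.
  by have /cvgrPdist_lt := @cvg_id _ (nbhs x); apply.
apply: filterS xnear => y xy.
by rewrite -raddfB (le_lt_trans (fM _))// mulrC -ltr_pdivlMr.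
Qed.

Lemma weak_open_functional (f : X -> K) (M a eps : K) :
  linear_for *%R f -> 0 < M -> (forall x, `|f x| <= M * `|x|) ->
  @open (weak_topology X) [set y | `|a - f y| < eps].
Proof.
move=> flin M0 fM.
pose L := GRing.isLinear.Build K X K _ f flin.
pose F : {scalar X} := HB.pack f L.
have Fcont : continuous F by exact: (@bounded_functional_continuous F M).
pose phi : dual_space X := exist _ F Fcont.
rewrite openE => y fy.
(* Convergence in a supremum topology implies convergence in each constituent; for the neighbourhood
   filter itself, this makes every [phi]-neighbourhood a weak one. *)
have := (@cvg_sup X (dual_space X)
  (fun g => Topological.class (initial_topology (sval g : X -> K)))
  (nbhs (y : weak_topology X)) y _).1 (fun _ H => H) phi.
apply; apply: (@open_nbhs_nbhs (initial_topology (F : X -> K))); split => //.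
exists (ball a eps); first by apply: ball_open; exact: le_lt_trans fy.
by apply/seteqP; split => z; rewrite /= -ball_normE.
Qed.

Lemma weak_open_bigI (U : nat -> set X) N :
  (forall j, @open (weak_topology X) (U j)) ->
  @open (weak_topology X) [set y | forall j, (j < N)%N -> U j y].
Proof.
move=> Uo; elim: N => [|N IH].
  rewrite (_ : mkset _ = setT); first exact: openT.
  by apply/seteqP; split.
rewrite (_ : mkset _ = U N `&` [set y | forall j, (j < N)%N -> U j y]).
  exact: (@openI (weak_topology X)).
apply/seteqP; split => y /=.
  by move=> Uy; split => [|j jN]; apply: Uy; rewrite ?ltnSn// ltnW.
by move=> [UN Uy] j; rewrite ltnS leq_eqVlt => /predU1P[->|/Uy].
Qed.

(** Otherwise [b] would be an upper bound below the supremum 2. Realness of [b] makes it comparable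
    with norms, since the order of [K] may be partial. *)
Lemma super_ADP_attained (x : X) (W : set X) (b : K) :
  super_ADP X -> `|x| = 1 ->
  relatively_weakly_open (@unit_ball K X) W -> W `&` @unit_sphere K X !=set0 ->
  b \is Num.real -> b < 2 ->
  exists y t, [/\ W y, `|t| = 1 & b < `|x + t *: y|].
Proof.
move=> XADP x1 Wo W0 b_real b2; apply: contrapT => noyt.
have [_ /(_ b)] := XADP x W x1 Wo W0.
suff bW : ubound [set m | exists2 y, W y &
    is_maximum [set `|x + t *: y| | t in unit_scalars] m] b.
  by move=> /(_ bW); rewrite real_leNgt ?realn ?b2.
move=> m [y Wy] [[t t1 <-] _].
rewrite real_leNgt ?normr_real//; apply/negP => ltb.
by apply: noyt; exists y, t.
Qed.

End WeakTopology.

(** * Distances to the unit disc of scalars *)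

Lemma radial_dist (K : numFieldType) (w : K) :
  exists2 a : K, `|a| <= 1 & `|w - a| = if `|w| <= 1 then 0 else `|w| - 1.
Proof.
case: ifPn => w1; first by exists w; rewrite // subrr normr0.
move: w1; rewrite -real_ltNge ?normr_real ?real1// => w1.
have w0 : 0 < `|w| := lt_trans ltr01 w1.
exists (w / `|w|); first by rewrite normf_div normr_id divff ?gt_eqF.
have -> : w - w / `|w| = w / `|w| * (`|w| - 1).
  by rewrite mulrBr mulr1 mulfVK ?gt_eqF.
by rewrite normrM normf_div normr_id divff ?gt_eqF// mul1r gtr0_norm ?subr_gt0.
Qed.

(** The real and complex cases are separated only here; squared moduli expand as squares or as
    products with the conjugate. *)
Lemma parallelogram (R : realType) (K : numFieldType) (x y : K) :
  real_or_complex R K ->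
  `|x + y| ^+ 2 + `|x - y| ^+ 2 = 2 * `|x| ^+ 2 + 2 * `|y| ^+ 2.
Proof.
move=> KR; case: K / KR x y => x y.
  by rewrite !real_normK ?num_real//; ring.
by rewrite !normCK !(rmorphD, rmorphB)/=; ring.
Qed.

(* [a] and [- b] are the points of the closed unit disc nearest to [r + t] and
   [r - t]. *)
Lemma radial_balance (R : realType) (K : numFieldType) (r t : K) :
  real_or_complex R K -> 0 < r -> r <= 4 / 3 -> `|t| = 1 ->
  exists a b, [/\ `|a| <= 1, `|b| <= 1 & `|r + t - a| + `|r - t + b| <= r].
Proof.
move=> KR r0 r43 t1.
have [a a1 a_dist] := radial_dist (r + t).
have [b b1 b_dist] := radial_dist (r - t).
exists a, (- b); split; rewrite ?normrN// a_dist b_dist.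
have le1 : forall w : K, `|w| <= r + 1 -> `|w| - 1 <= r.
  by move=> w; rewrite lerBlDr.
have p_le : `|r + t| <= r + 1.
  by rewrite (le_trans (ler_normD _ _))// t1 gtr0_norm.
have q_le : `|r - t| <= r + 1.
  by rewrite (le_trans (ler_normB _ _))// t1 gtr0_norm.
case: ifPn => _; case: ifPn => _.
- by rewrite addr0 ltW.
- by rewrite add0r le1.
- by rewrite addr0 le1.
(* Both points lie outside the disc, so the distances sum to $|r+t|+|r-t|-2$. *)
have /(_ r t) pq := parallelogram _ _ KR.
have pq2 : `|r + t| + `|r - t| <= r + 2.
  suff : (`|r + t| + `|r - t|) ^+ 2 <= (r + 2) ^+ 2.
    by rewrite ler_pXn2r ?nnegrE ?addr_ge0 ?(ltW r0).
  rewrite -subr_ge0.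
  (* The threshold 4/3 comes from $(r+2)^2-4(r^2+1)=3r(4/3-r)$. *)
  have -> : (r + 2) ^+ 2 - (`|r + t| + `|r - t|) ^+ 2 =
      3 * r * (4 / 3 - r) + (`|r + t| - `|r - t|) ^+ 2
      + 2 * (2 * `|r| ^+ 2 + 2 * `|t| ^+ 2 - (`|r + t| ^+ 2 + `|r - t| ^+ 2)).
    by rewrite t1 (gtr0_norm r0); field.
  rewrite pq subrr mulr0 addr0; apply: addr_ge0.
    by rewrite !mulr_ge0 ?subr_ge0 ?(ltW r0).
  by rewrite real_exprn_even_ge0// realB ?normr_real.
by rewrite addrACA -opprD lerBlDr (le_trans pq2).
Qed.

(** * Disjointly supported vectors under the super ADP *)

Section DisjointPairs.
Context {K : numFieldType} {X : normedModType K} {e : nat -> X} {k : K}.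
Hypothesis e_basis : schauder_basis e.
Hypothesis e_unc : unconditional_basis k e.
Hypothesis k_gt0 : 0 < k.
Hypothesis X_ADP : super_ADP X.

Local Notation coord := (coord e_basis).
Local Notation trunc := (trunc e_basis).

Lemma weak_open_coord j a eps :
  @open (weak_topology X) [set y | `|a - coord y j| < eps].
Proof.
have ej0 : 0 < `|e j| by rewrite normr_gt0 (basis_neq0 e_basis).
apply: (@weak_open_functional _ _ _ (k / `|e j|)).
- exact: coord_linear.
- by rewrite divr_gt0.
- by move=> x; rewrite mulrAC ler_pdivlMr// (coord_bounded _ e_unc).
Qed.

Lemma exists_disjoint_pair eta : 0 < eta -> exists N u v,
  [/\ `|u| <= 1, `|v| <= 1, forall j, coord u j = 0 \/ coord v j = 0,
      forall j, (N <= j)%N -> coord u j = 0 /\ coord v j = 0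
    & 2 - eta < `|u + v|].
Proof.
(* Five losses of [eps]: the supremum, the deleted coordinate 0, the truncation, and two for
   rescaling into the unit ball. *)
move=> eta0; pose eps := eta / 5.
have eps0 : 0 < eps by rewrite divr_gt0.
have e_gt0 j : 0 < `|e j| by rewrite normr_gt0 (basis_neq0 e_basis).
pose n j := `|e j|^-1 *: e j.
have n1 j : `|n j| = 1 by rewrite normrZ normfV normr_id mulVf ?gt_eqF.
pose U : set X := [set y | `|0 - coord y 0| < eps / `|e 0|].
have UoB : relatively_weakly_open (@unit_ball K X) (U `&` @unit_ball K X).
  by exists U => //; exact: weak_open_coord.
have U0 : (U `&` @unit_ball K X) `&` @unit_sphere K X !=set0.
  exists (n 1); split; last exact: n1.
  split; last by rewrite /unit_ball /= n1.
  by rewrite /U /= coordZ coord_basis mulr0 subr0 normr0 divr_gt0.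
have [||y [t [[Uy yB] t1 lt_xty]]] :=
  super_ADP_attained (b := 2 - eps) X_ADP (n1 0%N) UoB U0.
- by rewrite realB ?realn// gtr0_real.
- by rewrite gtrBl.
pose v1 := t *: (y - coord y 0 *: e 0).
have tyv1 : `|t *: y - v1| <= eps.
  rewrite -scalerBr subKr !normrZ t1 mul1r -ler_pdivlMr//.
  by move: Uy; rewrite /U /= sub0r normrN => /ltW.
have [N v1N] := trunc_approx e_basis v1 eps0.
pose v2 := trunc N v1; pose M := 1 + 2 * eps.
have M0 : 0 < M by rewrite addr_gt0// mulr_gt0.
pose v := M^-1 *: v2.
have v2_le : `|v2| <= M.
  have -> : v2 = t *: y - (t *: y - v1) - (v1 - v2) by rewrite !subKr.
  have -> : M = 1 + eps + eps by rewrite /M; ring.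
  rewrite (le_trans (ler_normB _ _))// lerD//; last exact: ltW.
  rewrite (le_trans (ler_normB _ _))// lerD//.
  by rewrite normrZ t1 mul1r.
have v_le : `|v| <= 1.
  by rewrite normrZ normfV (gtr0_norm M0) ler_pdivrMl ?mulr1.
have coord_v j : coord v j = M^-1 * if (j < N)%N then coord v1 j else 0.
  by rewrite coordZ coord_trunc.
(* The bound must also exceed index 0, the support of [n 0]. *)
exists (maxn N 1), (n 0%N), v; split => //.
- by rewrite n1.
- move=> [|j]; [right|left]; last by rewrite coordZ coord_basis mulr0.
  rewrite coord_v coordZ coordB coordZ coord_basis mulr1 subrr mulr0.
  by case: ifP; rewrite mulr0.
- move=> j; rewrite geq_max => /andP[Nj j1]; split.
    by rewrite coordZ coord_basis gtn_eqF ?mulr0.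
  by rewrite coord_v ltnNge Nj mulr0.
have -> : 2 - eta = 2 - eps - 4 * eps by rewrite /eps; field.
rewrite ltrBlDr (lt_le_trans lt_xty)//.
have -> : n 0%N + t *: y = (n 0%N + v) + ((v2 - v) + (v1 - v2) + (t *: y - v1)).
  rewrite -addrA; congr (_ + _).
  by rewrite [v2 - v + _]addrC subrKA [v1 - v + _]addrC subrKA addrC subrK.
rewrite (le_trans (ler_normD _ _))// lerD2l.
have -> : 4 * eps = 2 * eps + eps + eps by ring.
rewrite (le_trans (ler_normD _ _))// lerD//.
rewrite (le_trans (ler_normD _ _))// lerD//; last exact: ltW.
have -> : v2 - v = (2 * eps) *: v.
  by rewrite -{1}[v2](@scalerKV _ _ M) ?gt_eqF// -/v -{2}[v]scale1r
    -scalerBl addrAC subrr add0r.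
by rewrite normrZ gtr0_norm ?mulr_gt0// ler_piMr// mulr_ge0 ?ltW.
Qed.

(** The diagonal operator with entries [a], [b], [c] on the three disjoint supports shrinks every
    coordinate. *)
Lemma norm_le_multiplier (u v z : X) (a b c : K) (p q : K) :
  (forall j, coord u j = 0 \/ coord v j = 0) ->
  (forall j, (coord u j = 0 /\ coord v j = 0) \/ coord z j = 0) ->
  `|a| <= 1 -> `|b| <= 1 -> `|c| <= 1 ->
  `|(a * p) *: u + (b * q) *: v + c *: z| <= k * `|p *: u + q *: v + z|.
Proof.
move=> duv dz a1 b1 c1; apply: (unconditional_le e_unc k_gt0) => j.
rewrite !(coordD, coordZ).
have shrink (d x : K) : `|d| <= 1 -> `|d * x| <= `|x|.
  by move=> d1; rewrite normrM ler_piMl.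
case: (dz j) => [[-> ->]|->]; first by rewrite !mulr0 !add0r shrink.
by case: (duv j) => ->; rewrite !mulr0 ?addr0 ?add0r -mulrA shrink.
Qed.

(** A sign change on the support of [v]; it serves to show that [u - v] is nonzero and can be
    normalised. *)
Lemma unconditional_sub_le (u v : X) :
  (forall j, coord u j = 0 \/ coord v j = 0) -> `|u + v| <= k * `|u - v|.
Proof.
move=> duv; have := @norm_le_multiplier u v 0 1 (-1) 1 1 (-1) duv.
rewrite scaler0 !addr0 mulrNN mulr1 !scale1r scaleN1r normrN !normr1.
by apply => // j; right; rewrite coord0.
Qed.

Lemma disjoint_pair_contra (R : realType) (eps : K) N (u v : X) :
  real_or_complex R K ->
  `|u| <= 1 -> `|v| <= 1 ->
  (forall j, coord u j = 0 \/ coord v j = 0) ->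
  (forall j, (N <= j)%N -> coord u j = 0 /\ coord v j = 0) ->
  3 / 2 <= `|u + v| -> 0 < eps ->
  2 <= k * (1 + eps) + `|u + v|^-1 + eps.
Proof.
move=> KR u1 v1 duv uvN s32 eps0.
pose s := `|u + v|; pose s' := `|u - v|.
have s0 : 0 < s by apply: lt_le_trans s32; rewrite divr_gt0.
have s'0 : 0 < s'.
  by rewrite -(pmulr_rgt0 _ k_gt0) (lt_le_trans s0)// unconditional_sub_le.
have s'2 : s' <= 2.
  by rewrite (le_trans (ler_normB _ _))// (_ : 2 = 1 + 1)// lerD.
have r0 : 0 < s' / s by rewrite divr_gt0.
have r43 : s' / s <= 4 / 3.
  rewrite ler_pdivrMr// (le_trans s'2)//.
  rewrite (_ : 2 = 4 / 3 * (3 / 2)); last by field.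
  by rewrite ler_wpM2l// divr_ge0.
pose x := s^-1 *: (u + v); pose y0 := s'^-1 *: (u - v).
have x1 : `|x| = 1 by rewrite normrZ normfV normr_id mulVf ?gt_eqF.
have y01 : `|y0| = 1 by rewrite normrZ normfV normr_id mulVf ?gt_eqF.
(* Coordinate errors below [eps / E] add up to at most [eps] in norm; the summand 1 keeps [E]
   positive even for [N = 0]. *)
pose E := 1 + \sum_(j < N) `|e j|.
have E0 : 0 < E by rewrite ltr_pwDl ?sumr_ge0.
pose U := [set y | forall j, (j < N)%N -> `|coord y0 j - coord y j| < eps / E].
have UoB : relatively_weakly_open (@unit_ball K X) (U `&` @unit_ball K X).
  exists U => //; apply: (@weak_open_bigI K X
    (fun j => [set y | `|coord y0 j - coord y j| < eps / E])) => j.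
  exact: weak_open_coord.
have U0 : (U `&` @unit_ball K X) `&` @unit_sphere K X !=set0.
  exists y0; split => //; split; last by rewrite /unit_ball /= y01.
  by move=> j _; rewrite subrr normr0 divr_gt0.
rewrite real_leNgt ?realn//; last first.
  by rewrite ger0_real// !addr_ge0 ?mulr_ge0 ?addr_ge0 ?invr_ge0 ?ltW.
apply/negP => b2.
have [|y [t [[Uy yB] t1]]] := super_ADP_attained X_ADP x1 UoB U0 _ b2.
  by rewrite ger0_real// !addr_ge0 ?mulr_ge0 ?addr_ge0 ?invr_ge0 ?ltW.
apply/negP; rewrite -real_leNgt ?normr_real//; last first.
  by rewrite ger0_real// !addr_ge0 ?mulr_ge0 ?addr_ge0 ?invr_ge0 ?ltW.
pose z := y - trunc N y.
have y0N j : (N <= j)%N -> coord y0 j = 0.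
  by move=> /uvN[uj vj]; rewrite coordZ coordB uj vj subrr mulr0.
have near_y : `|y - (y0 + z)| <= eps.
  have -> : y - (y0 + z) = \sum_(j < N) (coord y j - coord y0 j) *: e j.
    have -> : y0 + z = y - (trunc N y - y0) by rewrite opprB addrCA.
    rewrite subKr.
    rewrite -{1}(trunc_id e_unc k_gt0 y0N) -sumrB.
    by apply: eq_bigr => j _; rewrite scalerBl.
  have -> : eps = eps / E * E by rewrite mulfVK ?gt_eqF.
  rewrite (le_trans (ler_norm_sum _ _ _))//
    (@le_trans _ _ (eps / E * \sum_(j < N) `|e j|))//.
    rewrite mulr_sumr ler_sum// => j _.
    by rewrite normrZ ler_wpM2r// distrC ltW// Uy.
  by rewrite ler_wpM2l ?lerDr// ltW// divr_gt0.
have w1 : `|y0 + z| <= 1 + eps.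
  by rewrite -[y0 + z](subKr y) (le_trans (ler_normB _ _))// lerD.
have [a [b [a1 b1 ab_le]]] := radial_balance KR r0 r43 t1.
pose g := (a * s'^-1) *: u + (b * - s'^-1) *: v + t *: z.
have g_le : `|g| <= k * (1 + eps).
  apply: (le_trans (norm_le_multiplier _ _ duv _ a1 b1 _)).
  - move=> j; have [/uvN|jN] := leqP N j; first by left.
    by right; rewrite coordB coord_trunc jN subrr.
  - by rewrite t1.
  - by rewrite ler_wpM2l ?(ltW k_gt0)// scaleNr -scalerBr.
(* With [r = s' / s], the coefficients of [x + t *: y0] on [u] and [v] are [(r + t) / s'] and
   [(r - t) / s']. Removing those of [g] leaves [A] and [B], whose moduli sum to at most [r / s'],
   which is the inverse of [s]. *)
pose A := (s' / s + t - a) / s'; pose B := (s' / s - t + b) / s'.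
have x_ty0 : x + t *: y0 =
    (a * s'^-1) *: u + (b * - s'^-1) *: v + (A *: u + B *: v).
  rewrite addrACA -(scalerDl u) -(scalerDl v) /x /y0 scalerA scalerDr scalerBr
    addrACA -scalerDl -scalerBl.
  by congr (_ *: _ + _ *: _); rewrite /A /B; field; rewrite !gt_eqF.
have -> : x + t *: y = g + (A *: u + B *: v) + t *: (y - (y0 + z)).
  rewrite -{1}(subrK (y0 + z) y) (scalerDr t (y - _)) (scalerDr t y0) /g.
  by rewrite [LHS]addrCA [LHS]addrC; congr (_ + _); rewrite addrA x_ty0 addrAC.
rewrite (le_trans (ler_normD _ _))// lerD//; last by rewrite normrZ t1 mul1r.
rewrite (le_trans (ler_normD _ _))// lerD//.
rewrite (le_trans (ler_normD _ _))// !normrZ /A /B normfV (gtr0_norm s'0).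
rewrite (@le_trans _ _ ((`|s' / s + t - a| + `|s' / s - t + b|) / s'))//.
  by rewrite mulrDl lerD// ler_piMr// divr_ge0// ltW.
by rewrite ler_pdivrMr// [leRHS]mulrC.
Qed.

End DisjointPairs.

(** * Choice of constants *)

Theorem theorem1p1 (R : realType) (K : numFieldType)
    (scalarsK : real_or_complex R K) (k : K) (ge1_k : 1 <= k)
    (lt32_k : k < 3 / 2) :
  ~ exists X : completeNormedModType K,
      [/\ infinite_dimensional X,
          exists e : nat -> X, unconditional_basis k e
        & super_ADP X].
Proof.
move=> [X [_ [e e_unc] X_ADP]].
have k0 : 0 < k by rewrite (lt_le_trans ltr01).
pose d := 3 / 2 - k.
have d0 : 0 < d by rewrite subr_gt0.
have d12 : d <= 1 / 2.
  by rewrite /d lerBlDr (_ : 3 / 2 = 1 / 2 + 1) ?lerD2l//; field.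
have [N [u [v [u1 v1 duv uvN s_gt]]]] :=
  exists_disjoint_pair e_unc.1 e_unc k0 X_ADP d0.
have s32 : 3 / 2 <= `|u + v|.
  apply/(le_trans _ (ltW s_gt)).
  by rewrite lerBrDr -lerBrDl (_ : 2 - 3 / 2 = 1 / 2)//; field.
have s0 : 0 < `|u + v| by apply: lt_le_trans s32; rewrite divr_gt0.
have eps0 : 0 < d / 12 by rewrite divr_gt0.
have := disjoint_pair_contra e_unc k0 X_ADP scalarsK u1 v1 duv uvN s32 eps0.
apply/negP; rewrite -real_ltNge ?realn//; last first.
  by rewrite ger0_real// !addr_ge0 ?(ltW eps0) ?mulr_ge0 ?addr_ge0
    ?invr_ge0 ?(ltW k0) ?(ltW eps0).
(* As the norm exceeds [2 - d], this follows from $(1/2+d/2)(2-d)=1+(d/2)(1-d)\ge 1$. *)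
have sV : `|u + v|^-1 <= 1 / 2 + d / 2.
  rewrite -[leLHS]mul1r ler_pdivrMr//.
  apply: (@le_trans _ _ ((1 / 2 + d / 2) * (2 - d))).
    rewrite -subr_ge0 (_ : _ - _ = d / 2 * (1 - d)); last by field.
    rewrite mulr_ge0 ?subr_ge0 ?divr_ge0 ?(ltW d0)//.
    by rewrite (le_trans d12)// ler_pdivrMr// mul1r ler1n.
  by rewrite ler_wpM2l ?(ltW s_gt)// addr_ge0// divr_ge0// ltW.
(* Since [k + 1 / 2 = 2 - d], this sum equals [2 - d / 4]. *)
apply: (@le_lt_trans _ _ (k + 2 * (d / 12) + (1 / 2 + d / 2) + d / 12)).
  rewrite lerD2r lerD// mulrDr mulr1 lerD2l ler_wpM2r ?(ltW eps0)//.
  by rewrite (le_trans (ltW lt32_k))// ler_pdivrMr// -natrM ler_nat.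
rewrite -subr_gt0 (_ : _ - _ = d / 4) ?divr_gt0//.
by rewrite /d; field.
Qed.
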